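(* Fix an imprecise probabilities tree with finite state space $\mathscr{X}$, and let $\overline{\mathrm{E}}_{\mathrm V}$ be the corresponding game-theoretic upper expectation. For any $f\colon\Omega\to\overline{\mathbb{R}}$ and any situation $s\in\mathscr{X}^{\ast}$, \[\overline{\mathrm{E}}_{\mathrm V}(f\vert s)=\inf\{\mathscr{M}(s):\mathscr{M}\in\overline{\mathbb{M}}_{\mathrm b}\text{ and }\liminf\mathscr{M}\ge_s f\text{ s.a.s.}\},\] where ''$\liminf\mathscr{M}\ge_s f$ s.a.s.'' means that the event $\{\omega\in\Omega:\liminf\mathscr{M}(\omega)\ge f(\omega)\}$ is strictly almost sure within $\Gamma(s)$.
   Context: Notation: $\mathbb{N}=\{1,2,\dots\}$, $\mathbb{N}_0=\mathbb{N}\cup\{0\}$, $\overline{\mathbb{R}}=\mathbb{R}\cup\{-\infty,+\infty\}$, with conventions $+\infty-\infty=-\infty+\infty=+\infty$, $0\cdot(\pm\infty)=0$, $\inf\emptyset=+\infty$. For a non-empty set $\mathscr{Y}$, $\overline{\mathscr{L}}(\mathscr{Y})$ is the set of all maps $\mathscr{Y}\to\overline{\mathbb{R}}$ and $\overline{\mathscr{L}}_b(\mathscr{Y})$ the subset of those bounded below by a real constant. Limits and inequalities of functions are pointwise. Local models: $\mathscr{X}$ is a finite non-empty set. $\mathscr{X}^{\ast}=\bigcup_{n\in\mathbb{N}_0}\mathscr{X}^n$ is the set of situations (finite strings, including the empty string $\Box$). An imprecise probabilities tree assigns to each $s\in\mathscr{X}^{\ast}$ a map $\overline{\mathrm{Q}}_s\colon\overline{\mathscr{L}}(\mathscr{X})\to\overline{\mathbb{R}}$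 that is an upper expectation, i.e. satisfies: (E1) $\overline{\mathrm{Q}}_s(c)=c$ for all $c\in\mathbb{R}$; (E2) $\overline{\mathrm{Q}}_s(f+g)\le\overline{\mathrm{Q}}_s(f)+\overline{\mathrm{Q}}_s(g)$ for all $f,g\in\overline{\mathscr{L}}_b(\mathscr{X})$; (E3) $\overline{\mathrm{Q}}_s(\lambda f)=\lambda\overline{\mathrm{Q}}_s(f)$ for all real $\lambda>0$ and $f\in\overline{\mathscr{L}}_b(\mathscr{X})$; (E4) $f\le g\Rightarrow\overline{\mathrm{Q}}_s(f)\le\overline{\mathrm{Q}}_s(g)$ for all $f,g\in\overline{\mathscr{L}}_b(\mathscr{X})$; (E5) $\lim_n\overline{\mathrm{Q}}_s(f_n)=\overline{\mathrm{Q}}_s(\lim_n f_n)$ for every non-decreasing sequence $\{f_n\}_{n\in\mathbb{N}_0}$ of non-negative variables in $\overline{\mathscr{L}}_b(\mathscr{X})$. Global model: $\Omega=\mathscr{X}^{\mathbb{N}}$ is the set of paths; for $\omega\in\Omega$, $\omega^n\in\mathscr{X}^n$ is the string of its first $n$ values; $\Gamma(x_{1:n})=\{\omega\in\Omega:\omega^n=x_{1:n}\}$. For $g,h\colon\Omega\to\overline{\mathbb{R}}$, $g\ge_s h$ means $g(\omega)\ge h(\omega)$ for all $\omega\in\Gamma(s)$. A supermartingale is a map $\mathscr{M}\colon\mathscr{X}^{\ast}\to\overline{\mathbb{R}}$ with $\overline{\mathrm{Q}}_s(\mathscr{M}(s\,\cdot))\le\mathscr{M}(s)$ for all $s\in\mathscr{X}^{\ast}$,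 where $\mathscr{M}(s\,\cdot)\in\overline{\mathscr{L}}(\mathscr{X})$ is $x\mapsto\mathscr{M}(sx)$. $\overline{\mathbb{M}}_{\mathrm b}$ is the set of supermartingales bounded below by a real constant, and $\liminf\mathscr{M}(\omega)=\liminf_{n\to+\infty}\mathscr{M}(\omega^n)$. The game-theoretic upper expectation is, for all $f\colon\Omega\to\overline{\mathbb{R}}$ and $s\in\mathscr{X}^{\ast}$, \[\overline{\mathrm{E}}_{\mathrm V}(f\vert s)=\inf\{\mathscr{M}(s):\mathscr{M}\in\overline{\mathbb{M}}_{\mathrm b},\ \liminf\mathscr{M}\ge_s f\}.\] For $s\in\mathscr{X}^{\ast}$, an $s$-test supermartingale is a non-negative supermartingale $\mathscr{M}$ with $\mathscr{M}(s)=1$. An event $A\subseteq\Omega$ is strictly almost sure (s.a.s.) within $\Gamma(s)$ if there is an $s$-test supermartingale $\mathscr{M}$ with $\lim_{n\to+\infty}\mathscr{M}(\omega^n)=+\infty$ for all $\omega\in\Gamma(s)\setminus A$. *)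

(* Defs.v *)
From mathcomp Require Import all_boot all_order all_algebra.
From mathcomp Require Import boolp classical_sets reals ereal.
From mathcomp Require Import topology normedtype sequences.

Set Implicit Arguments.
Unset Strict Implicit.
Unset Printing Implicit Defensive.

Local Open Scope classical_set_scope.
Local Open Scope ereal_scope.

Definition bounded_below (R : realType) (Y : Type) (f : Y -> \bar R) : Prop :=
  exists B : R, forall y, B%:E <= f y.

(* The scope [%dE] selects the addition with +oo + -oo = -oo + +oo = +oo;
   the default addition of [\bar R] would give -oo. *)
Record upper_expectation (R : realType) (X : finType)
    (E : (X -> \bar R) -> \bar R) : Prop := UpperExpectation {
  upexp_cst : forall c : R, E (fun=> c%:E) = c%:E ;
  upexp_subadd : forall f g : X -> \bar R,
    bounded_below f -> bounded_below g ->
    E (fun x => (f x + g x)%dE) <= (E f + E g)%dE ;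
  upexp_scale : forall (lambda : R) (f : X -> \bar R),
    (0 < lambda)%R -> bounded_below f ->
    E (fun x => lambda%:E * f x) = lambda%:E * E f ;
  upexp_mono : forall f g : X -> \bar R,
    bounded_below f -> bounded_below g ->
    (forall x, f x <= g x) -> E f <= E g ;
  upexp_cvg : forall f : nat -> X -> \bar R,
    (forall n x, 0 <= f n x) ->
    (forall n x, f n x <= f n.+1 x) ->
    (fun n => E (f n)) @ \oo --> E (fun x => limn (fun n => f n x))
}.

(* Situations are [seq X]; a path is a function [nat -> X], whose value at k
   is the state at time k.+1. *)
Definition path_prefix (X : finType) (omega : nat -> X) (n : nat) : seq X :=
  mkseq omega n.

Definition cylinder (X : finType) (s : seq X) : set (nat -> X) :=
  [set omega | path_prefix omega (size s) = s].

Section GameTheoretic.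
Context (R : realType) (X : finType).
Variable Q : seq X -> (X -> \bar R) -> \bar R.
Implicit Types (M : seq X -> \bar R) (s t : seq X) (A : set (nat -> X)).

Definition supermartingale M : Prop :=
  forall t, Q t (fun x => M (rcons t x)) <= M t.

Definition bounded_below_supermartingale M : Prop :=
  supermartingale M /\ bounded_below M.

Definition path_liminf M (omega : nat -> X) : \bar R :=
  limn_einf (fun n => M (path_prefix omega n)).

Definition game_upper_expectation (f : (nat -> X) -> \bar R) s : \bar R :=
  ereal_inf [set M s | M in [set M | bounded_below_supermartingale M /\
    forall omega, cylinder s omega -> f omega <= path_liminf M omega]].

Definition test_supermartingale s M : Prop :=
  [/\ supermartingale M, forall t, 0 <= M t & M s = 1].

Definition strictly_almost_sure s A : Prop :=
  exists2 M, test_supermartingale s M &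
    forall omega, (cylinder s `\` A) omega ->
      (fun n => M (path_prefix omega n)) @ \oo --> +oo.

End GameTheoretic.

(* Main.v *)
Require Import Defs.
From mathcomp Require Import all_boot all_order all_algebra.
From mathcomp Require Import boolp classical_sets reals ereal.
From mathcomp Require Import topology normedtype sequences.

(** If T is a test supermartingale tending to +oo on the exceptional paths,
    then M + e T is again a supermartingale, its inferior limit dominates that
    of M and equals +oo on the exceptional paths, and at s it exceeds M by only
    e. Letting e tend to 0 removes the exceptional paths at no cost. *)

Import Order.TTheory GRing.Theory Num.Theory DualAddTheory.

Local Open Scope classical_set_scope.
Local Open Scope ereal_scope.

Lemma le_limn_einf (R : realType) (u v : nat -> \bar R) :
  (forall n, u n <= v n) -> limn_einf u <= limn_einf v.
Proof.
move=> le_uv; rewrite !limn_einf_lim.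
apply: lee_lim; [exact: is_cvg_einfs | exact: is_cvg_einfs |].
apply: nearW => n; apply: le_ereal_inf_tmp => _ [k /= nk <-].
by apply: le_trans (le_uv k); apply: ereal_inf_lbound; exists k.
Qed.

(** The uniform bound [B] keeps [u] from offsetting the growth of [v]: the sum is at least [A] as
    soon as [v] is at least [A - B]. *)
Lemma limn_einf_dadd_pinfty (R : realType) (u v : nat -> \bar R) (B : R) :
  (forall n, B%:E <= u n) -> v @ \oo --> +oo ->
  limn_einf (fun n => (u n + v n)%dE) = +oo.
Proof.
move=> Bu /cvgeyPge v_pinfty.
suff /cvg_limn_einf_sup[-> //] : (fun n => (u n + v n)%dE) @ \oo --> +oo.
apply/cvgeyPge => A; apply: filterS (v_pinfty (A - B)%R) => n Av.
have -> : A%:E = (B%:E + (A - B)%:E)%dE.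
  by rewrite -dEFinD addrC subrK.
exact: lee_dD.
Qed.

Section TestSupermartingales.
Context (R : realType) (X : finType) (Q : seq X -> (X -> \bar R) -> \bar R).
Hypothesis Q_upexp : forall t : seq X, upper_expectation (Q t).
Implicit Types (M T : seq X -> \bar R) (s : seq X).

(** Subadditivity splits the local upper expectation of the sum, and positive homogeneity takes [e]
    out of the second term. Since [e%:E * T] is non-negative, a lower bound of [M] also bounds the
    sum. *)
Lemma bounded_below_supermartingale_dadd M T (e : R) : (0 < e)%R ->
  bounded_below_supermartingale Q M ->
  supermartingale Q T -> (forall t, 0 <= T t) ->
  bounded_below_supermartingale Q (fun t => (M t + e%:E * T t)%dE).
Proof.
move=> e_gt0 [superM [B BM]] superT T_ge0.
have eT_ge0 t : 0 <= e%:E * T t by rewrite mule_ge0// lee_fin ltW.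
split; last first.
  by exists B => t; rewrite (le_trans (BM t))// lee_dDl.
move=> t; have [_ subadd scale _ _] := Q_upexp t.
have T_below : bounded_below (fun x => T (rcons t x)) by exists 0%R.
have M_below : bounded_below (fun x => M (rcons t x)) by exists B.
have eT_below : bounded_below (fun x => e%:E * T (rcons t x)) by exists 0%R.
apply: le_trans (subadd _ _ M_below eT_below) _.
by rewrite scale// lee_dD// lee_pmul2l.
Qed.

(** The constant 1 is a test supermartingale, and no path of the cylinder is left on which it would
    have to diverge. *)
Lemma strictly_almost_sure_superset s (A : set (nat -> X)) :
  cylinder s `<=` A -> strictly_almost_sure Q s A.
Proof.
move=> sA; exists (fun=> 1); last by move=> omega [/sA].
by split=> // t; have [->] := Q_upexp t.
Qed.

Lemma game_upper_expectation_le (f : (nat -> X) -> \bar R) s M :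
  bounded_below_supermartingale Q M ->
  strictly_almost_sure Q s [set omega | f omega <= path_liminf M omega] ->
  game_upper_expectation Q f s <= M s.
Proof.
move=> superM [T [superT T_ge0 Ts] T_pinfty].
apply/lee_addgt0Pr => e e_gt0.
have [_ [B BM]] := superM.
(* The two additions of [\bar R] agree here, even if [M s] is infinite, because the other summand is
   the real [e]. *)
have -> : M s + e%:E = (M s + e%:E * T s)%dE.
  by rewrite Ts mule1; case: (M s).
apply: ereal_inf_lbound; exists (fun t => (M t + e%:E * T t)%dE) => //.
split; first exact: bounded_below_supermartingale_dadd.
move=> omega s_omega.
have [f_le|f_nle] := pselect (f omega <= path_liminf M omega).
  apply: le_trans f_le _; apply: le_limn_einf => n.
  by rewrite lee_dDl// mule_ge0// lee_fin ltW.
(* On an exceptional path [T] tends to +oo, and so does [e%:E * T]: it passes [A] once [T] passes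
   [e^-1 * A]. *)
rewrite /path_liminf (limn_einf_dadd_pinfty _ _ _ B) ?leey//.
have /cvgeyPge T_oo := T_pinfty omega (conj s_omega f_nle).
apply/cvgeyPge => A; apply: filterS (T_oo (e^-1 * A)%R) => n AT.
by rewrite -(mulVKf (lt0r_neq0 e_gt0) A) EFinM lee_pmul2l.
Qed.

End TestSupermartingales.

Theorem proposition21 (R : realType) (X : finType) (X_nonempty : (0 < #|X|)%N)
    (Q : seq X -> (X -> \bar R) -> \bar R)
    (Q_upexp : forall t : seq X, upper_expectation (Q t))
    (f : (nat -> X) -> \bar R) (s : seq X) :
  game_upper_expectation Q f s =
  ereal_inf [set M s | M in [set M : seq X -> \bar R |
    bounded_below_supermartingale Q M /\
    strictly_almost_sure Q s
      [set omega : nat -> X | f omega <= path_liminf M omega]]].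
Proof.
apply/eqP; rewrite eq_le; apply/andP; split.
  apply: le_ereal_inf_tmp => _ [M [superM sasM] <-].
  exact: game_upper_expectation_le.
(* Domination on the whole cylinder is a special case of strictly almost sure domination, so the
   right-hand infimum runs over a larger set. *)
apply: ereal_inf_le_tmp => _ [M [superM f_le] <-]; exists M => //.
by split=> //; apply: strictly_almost_sure_superset.
Qed.
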